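(* Let $k\ge 1$ and $n\ge 1$ be integers. The number $\mathrm{sw}_{n,k}$ of smooth words of length $n$ over the alphabet $[k]$ is given by $$\mathrm{sw}_{n,k}=\frac{1}{k+1}\sum_{j=1}^k\bigl(1+(-1)^{j+1}\bigr)\cot^2\!\Big(\frac{j\pi}{2(k+1)}\Big)\Big(1+2\cos\frac{j\pi}{k+1}\Big)^{n-1},$$ or alternatively by $$\mathrm{sw}_{n,k}=\frac{2}{k+1}\sum_{0\le j\le\frac{k-1}{2}}\cot^2\!\Big(\frac{(2j+1)\pi}{2(k+1)}\Big)\Big(1+2\cos\frac{(2j+1)\pi}{k+1}\Big)^{n-1},$$ where $j$ in the second sum runs over integers.
   Context: $[k]=\{1,2,\ldots,k\}$, and $[k]^n$ is the set of words $\sigma=\sigma_1\cdots\sigma_n$ of length $n$ over $[k]$. A word $\sigma\in[k]^n$ is smooth if $|\sigma_{i+1}-\sigma_i|\le 1$ for all $1\le i\le n-1$ (so every word of length $1$ is smooth). *)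

(* Defs.v *)
From HB Require Import structures.
From mathcomp Require Import all_boot all_order all_algebra.
From mathcomp Require Import reals trigo.

Set Implicit Arguments.
Unset Strict Implicit.
Unset Printing Implicit Defensive.

Import Order.TTheory GRing.Theory Num.Theory.

Local Open Scope ring_scope.

(* The alphabet {1, ..., k} is represented by 'I_k, the ordinal i standing for
   the letter i + 1; only differences of letters matter below. *)
Definition smooth (k n : nat) (w : n.-tuple 'I_k) : bool :=
  sorted (fun a b : 'I_k => `|b%:Z - a%:Z| <= 1) w.

Definition sw (n k : nat) : nat := #|[set w : n.-tuple 'I_k | smooth w]|.

Definition cot (R : realType) (x : R) : R := cos x / sin x.

(* Main.v *)
Require Import Defs.
From HB Require Import structures.
From mathcomp Require Import all_boot all_order all_algebra.
From mathcomp Require Import reals trigo.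
From mathcomp Require Import ring zify.

(** Let [N = k + 1] and [t_j = j pi / N].  The number [e_n a] of ways to extend
    a letter [a] by [n] further letters, keeping the word smooth, satisfies
    [e_(n+1) a = e_n (a-1) + e_n a + e_n (a+1)], where [e_n] is read as [0] at
    the two positions [0] and [N] just outside the alphabet.  This is a
    transfer operator with Dirichlet boundary conditions, so the functions
    [a |-> sin (a t_j)] diagonalize it, with eigenvalues [1 + 2 cos t_j]
    (the computation is in [smooth_extensions_sine_expansion]).

    What remains is to expand the initial condition [e_0 = 1] in these
    eigenfunctions, and to sum an eigenfunction over the alphabet:
      - [sine_expansion_one]: for [0 < m < N],
        [\sum_j (1 - (-1)^j) cot (t_j / 2) sin (m t_j) = N];
      - [sum_sin_half_angle]: for [0 < j < N],
        [\sum_(l < N) sin (l t_j) = (1 - (-1)^j) / 2 * cot (t_j / 2)].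
    The cotangent thus occurs once in the coefficient and once in the sum,
    hence the square, and the even indices contribute nothing, hence the
    second form of the result.

    Both facts come from telescoping [sum_sin_mul2] and [sum_cos_mul2].  For
    the expansion of [1], the increment in [m] of the left-hand side is
    [\sum_j (1 - (-1)^j) (cos (m t_j) + cos ((m+1) t_j))]: multiplication by
    [cot (t_j / 2)] turns a difference of sines into a sum of cosines.  By
    [signed_sum_cos_adjacent] that increment is [N] for [m = 0] and vanishes
    afterwards. *)

Set Implicit Arguments.
Unset Strict Implicit.
Unset Printing Implicit Defensive.

Import Order.TTheory GRing.Theory Num.Theory.

Local Open Scope ring_scope.

(** * Recursion on the first letter *)

Definition adjacent (k : nat) (a b : 'I_k) : bool := `|b%:Z - a%:Z| <= 1.

Definition smooth_extensions (k n : nat) (a : 'I_k) : nat :=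
  #|[set w : n.-tuple 'I_k | path (@adjacent k) a w]|.

Lemma card_tuple_cons (T : finType) (n : nat) (P : pred (seq T)) :
  #|[set w : n.+1.-tuple T | P w]|
  = (\sum_(a : T) #|[set w : n.-tuple T | P (a :: w)]|)%N.
Proof.
rewrite -sum1dep_card (eq_bigr _ (fun a _ => esym (sum1dep_card _))).
rewrite pair_big_dep /=.
rewrite (reindex (fun p : T * n.-tuple T => [tuple of p.1 :: p.2])) //=.
exists (fun w : n.+1.-tuple T => (thead w, [tuple of behead w])) => [[a w]|w] _ /=.
  by congr pair; apply: val_inj.
by rewrite -tuple_eta.
Qed.

Lemma sw_smooth_extensions (k n : nat) :
  sw n.+1 k = (\sum_(a : 'I_k) smooth_extensions n a)%N.
Proof. exact: (card_tuple_cons n (sorted (@adjacent k))). Qed.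

Lemma smooth_extensions0 (k : nat) (a : 'I_k) : smooth_extensions 0 a = 1%N.
Proof.
rewrite /smooth_extensions -[RHS](card_tuple 0 'I_k) -cardsT.
by apply: eq_card => w; rewrite !inE tuple0.
Qed.

Lemma smooth_extensionsS (k n : nat) (a : 'I_k) :
  smooth_extensions n.+1 a
  = (\sum_(b | adjacent a b) smooth_extensions n b)%N.
Proof.
rewrite /smooth_extensions (card_tuple_cons n (path (@adjacent k) a)) /=.
rewrite [RHS]big_mkcond; apply: eq_bigr => b _.
by case: ifP => // _; apply: eq_card0 => w; rewrite !inE.
Qed.

(** The tridiagonal transfer operator acts on a function that vanishes at both
    ends as the full three-term sum, since the missing neighbours of the first
    and last letters contribute zero.  The ordinal [b] is the letter [b.+1],
    hence the shift: the middle term is [G a.+1]. *)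
Lemma sum_adjacent (V : zmodType) (k : nat) (a : 'I_k) (G : nat -> V) :
  G 0%N = 0 -> G k.+1 = 0 ->
  \sum_(b | adjacent a b) G b.+1 = G a + G a.+1 + G a.+2.
Proof.
move=> G0 Gk.
(* Both sides become sums over positions 0, ..., k + 1, boundary included. *)
have -> : G a + G a.+1 + G a.+2 = \sum_(a <= i < a.+3) G i.
  by rewrite !big_nat_recr ?leqnn //= ?big_geq ?add0r //; lia.
rewrite (@big_nat_widen _ _ _ _ _ k.+2); last by have := ltn_ord a; lia.
rewrite big_geq_mkord /= [RHS]big_mkcond big_ord_recl big_ord_recr /= G0 Gk.
rewrite !if_same add0r addr0 [LHS]big_mkcond /=.
apply: eq_bigr => b _; rewrite /adjacent /bump /= add1n.
by congr (if _ then _ else _); have := ltn_ord b; lia.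
Qed.

(** * Trigonometric sums *)

Lemma alternating_natpi (R : realType) (f : R -> R) : alternating f pi ->
  forall (m : nat) (x : R), f (x + m%:R * pi) = (-1) ^+ m * f x.
Proof. by move=> fpi m x; rewrite mulr_natl alternatingn. Qed.

Lemma sin_mul2 (R : realType) (x : R) : sin (2 * x) = 2 * sin x * cos x.
Proof. by rewrite mulr_natl sin_mulr2n; ring. Qed.

Lemma cos_mul2 (R : realType) (x : R) : cos (2 * x) = 1 - 2 * sin x ^+ 2.
Proof. by rewrite mulr_natl cos_mulr2n cos2sin2; ring. Qed.

(** Since [2 sin x sin (2 l x) = cos ((2 l - 1) x) - cos ((2 l + 1) x)], the
    sum telescopes. *)
Lemma sum_sin_mul2 (R : realType) (x : R) (N : nat) :
  2 * sin x * \sum_(l < N) sin (l%:R * (2 * x))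
  = cos x - cos (N%:R * (2 * x) - x).
Proof.
elim: N => [|N IHN]; first by rewrite big_ord0 mul0r sub0r cosN; ring.
rewrite big_ord_recr mulrDr {}IHN /=.
have -> : N.+1%:R * (2 * x) - x = N%:R * (2 * x) + x by rewrite -natr1; ring.
by rewrite cosB cosD; ring.
Qed.

Lemma sum_cos_mul2 (R : realType) (x : R) (N : nat) :
  2 * sin x * \sum_(l < N) cos (l%:R * (2 * x))
  = sin x + sin (N%:R * (2 * x) - x).
Proof.
elim: N => [|N IHN]; first by rewrite big_ord0 mul0r sub0r sinN; ring.
rewrite big_ord_recr mulrDr {}IHN /=.
have -> : N.+1%:R * (2 * x) - x = N%:R * (2 * x) + x by rewrite -natr1; ring.
by rewrite sinB sinD; ring.
Qed.

(** The angle [t_j / 2], where [t_j = j pi / N] is the [j]-th frequency: the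
    telescoping identities involve half the step, and the doubled angle is
    then free of division. *)
Definition half_angle (R : realType) (N j : nat) : R :=
  j%:R * pi / (2 * N%:R).

Section HalfAngle.
Variables (R : realType) (N : nat).
Hypothesis N_gt0 : (0 < N)%N.
Local Notation h := (half_angle R N).

Let N_neq0 : N%:R != 0 :> R. Proof. by rewrite pnatr_eq0 -lt0n. Qed.

Lemma mul2_half_angle (j : nat) : 2 * h j = j%:R * pi / N%:R.
Proof. by rewrite /half_angle; field. Qed.

Lemma mulN_half_angle (j : nat) : N%:R * (2 * h j) = j%:R * pi.
Proof. by rewrite /half_angle; field. Qed.

Lemma sin_half_angle_neq0 (j : nat) : (0 < j < 2 * N)%N -> sin (h j) != 0.
Proof.
case/andP=> j_gt0 j_lt; apply/lt0r_neq0/sin_gt0_pi.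
rewrite /half_angle -mulrA mulrCA.
have D_gt0 : 0 < 2 * N%:R :> R by rewrite -natrM ltr0n muln_gt0.
rewrite pmulr_rgt0 ?pi_gt0 // divr_gt0 ?ltr0n //=.
by rewrite gtr_pMr ?pi_gt0 // ltr_pdivrMr // mul1r -natrM ltr_nat.
Qed.

Lemma sum_sin_half_angle (j : nat) : (0 < j < 2 * N)%N ->
  \sum_(l < N) sin (l%:R * (2 * h j)) = (1 - (-1) ^+ j) / 2 * cot (h j).
Proof.
move=> /sin_half_angle_neq0 s0; have := sum_sin_mul2 (h j) N.
rewrite mulN_half_angle [_ * pi - _]addrC (alternating_natpi (@cosDpi R)).
rewrite cosN => E; apply: (mulfI (_ : 2 * sin (h j) != 0)).
  by rewrite mulf_neq0 // pnatr_eq0.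
by rewrite E /cot; field.
Qed.

Lemma sum_cos_half_angle (m : nat) : (0 < m < 2 * N)%N ->
  \sum_(j < N) cos (j%:R * (2 * h m)) = (1 - (-1) ^+ m) / 2.
Proof.
move=> /sin_half_angle_neq0 s0; have := sum_cos_mul2 (h m) N.
rewrite mulN_half_angle [_ * pi - _]addrC (alternating_natpi (@sinDpi R)).
rewrite sinN => E; apply: (mulfI (_ : 2 * sin (h m) != 0)).
  by rewrite mulf_neq0 // pnatr_eq0.
by rewrite E; field.
Qed.

(** The sign [(-1)^j] is absorbed by translating the frequency index by [N],
    because [cos (y + j pi) = (-1)^j cos y]; moreover [m t_j = j t_m], which
    lets [sum_cos_half_angle] apply. *)
Lemma signed_sum_cos (m : nat) :
  \sum_(j < N) (1 - (-1) ^+ j) * cos (m%:R * (2 * h j))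
  = \sum_(j < N) cos (j%:R * (2 * h m))
    - \sum_(j < N) cos (j%:R * (2 * h (m + N))).
Proof.
rewrite -sumrB; apply: eq_bigr => j _; rewrite mulrBl mul1r.
have -> : m%:R * (2 * h j) = j%:R * (2 * h m) by rewrite /half_angle; field.
have -> : j%:R * (2 * h (m + N)) = j%:R * (2 * h m) + j%:R * pi.
  by rewrite /half_angle natrD; field.
by rewrite (alternating_natpi (@cosDpi R)).
Qed.

(** For an index strictly between [0] and [2 N], the unsigned cosine sum
    depends only on the parity of the index, so the contributions of [m] and
    [m + 1] cancel.  The exception is [m = 0], where
    one of the sums has all its terms equal to [1]. *)
Lemma signed_sum_cos_adjacent (m : nat) : (m.+1 < N)%N ->
  \sum_(j < N) (1 - (-1) ^+ j)
     * (cos (m%:R * (2 * h j)) + cos (m.+1%:R * (2 * h j)))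
  = if m == 0%N then N%:R else 0.
Proof.
move=> mN; under eq_bigr do rewrite mulrDr.
rewrite big_split /= !signed_sum_cos.
rewrite ![\sum_(_ < N) cos (_ * (2 * h (_ + _)))]sum_cos_half_angle; try lia.
rewrite [\sum_(_ < N) cos (_ * (2 * h m.+1))]sum_cos_half_angle; last lia.
case: eqP => [->|m0].
  under eq_bigr do rewrite /half_angle !mul0r !mulr0 cos0.
  by rewrite sumr_const card_ord add0n addSn add0n !exprS; field.
rewrite sum_cos_half_angle; last lia.
by rewrite addSn !exprS; field.
Qed.

(** The coefficients of the constant function [1] in the basis of
    eigenfunctions, obtained by summing in [m] the identity
    [cot (t / 2) (sin ((m + 1) t) - sin (m t)) = cos (m t) + cos ((m + 1) t)].
    The sum starts at [j = 0] so that complete cosine sums appear; that term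
    is zero because of the factor [1 - (-1)^j]. *)
Lemma sine_expansion_one (m : nat) : (0 < m < N)%N ->
  \sum_(j < N) (1 - (-1) ^+ j) * cot (h j) * sin (m%:R * (2 * h j)) = N%:R.
Proof.
case: m => // m /=.
have step m' : (m'.+1 < N)%N ->
    \sum_(j < N) (1 - (-1) ^+ j) * cot (h j) * sin (m'.+1%:R * (2 * h j))
  = \sum_(j < N) (1 - (-1) ^+ j) * cot (h j) * sin (m'%:R * (2 * h j))
    + (if m' == 0%N then N%:R else 0).
  move=> m'N; rewrite -signed_sum_cos_adjacent // -big_split /=.
  apply: eq_bigr => -[[|j] jN] _ /=; first by rewrite subrr !mul0r addr0.
  have s0 : sin (h j.+1) != 0 by apply: sin_half_angle_neq0; lia.
  rewrite -[m'.+1%:R]natr1 [(m'%:R + 1) * _]mulrDl mul1r.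
  rewrite sinD cosD sin_mul2 cos_mul2 /cot.
  have := cos2sin2 (h j.+1).
  move: (cos (h _)) (sin (h _)) s0 => c s s0 c2.
  move: (sin (_ * _)) (cos (_ * _)) => sa ca.
  apply/eqP; rewrite -subr_eq0; apply/eqP.
  set e := (-1) ^+ _.
  (* The two sides differ by a multiple of the Pythagorean relation. *)
  transitivity ((1 - e) * (2 * ca * (c ^+ 2 - (1 - s ^+ 2)))).
    by field.
  by rewrite c2 subrr !mulr0.
elim: m => [|m IHm] mN; rewrite step //.
  by rewrite big1 ?add0r // => j _; rewrite mul0r sin0 mulr0.
by rewrite IHm ?addr0 //; lia.
Qed.

End HalfAngle.

(** * The spectral expansion *)

(** At [n = 0] this is the expansion of the constant [1]; each added letter
    multiplies the mode [j] by its eigenvalue, because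
    [sin (y - t) + sin y + sin (y + t) = (1 + 2 cos t) sin y]. *)
Lemma smooth_extensions_sine_expansion (R : realType) (k n : nat) (a : 'I_k) :
  (k.+1)%:R * (smooth_extensions n a)%:R
  = \sum_(j < k.+1) (1 - (-1) ^+ j) * cot (half_angle R k.+1 j)
      * sin (a.+1%:R * (2 * half_angle R k.+1 j))
      * (1 + 2 * cos (2 * half_angle R k.+1 j)) ^+ n.
Proof.
elim: n a => [|n IHn] a.
  rewrite smooth_extensions0 mulr1.
  rewrite -[LHS](@sine_expansion_one R k.+1 _ a.+1) ?ltnS ?ltn_ord //.
  by apply: eq_bigr => j _; rewrite expr0 mulr1.
rewrite smooth_extensionsS natr_sum mulr_sumr (eq_bigr _ (fun b _ => IHn b)).
rewrite exchange_big /=; apply: eq_bigr => j _.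
rewrite -mulr_suml -mulr_sumr -[LHS]mulrA -[RHS]mulrA; congr (_ * _).
set x := 2 * half_angle R k.+1 j; rewrite exprS [RHS]mulrA; congr (_ * _).
have sin_0x : sin (0%:R * x) = 0 by rewrite mul0r sin0.
have sin_Nx : sin (k.+1%:R * x) = 0.
  rewrite mulN_half_angle // -[_ * pi]add0r (alternating_natpi (@sinDpi R)).
  by rewrite sin0 mulr0.
have /= -> := sum_adjacent (G := fun m => sin (m%:R * x)) a sin_0x sin_Nx.
have -> : a%:R * x = a.+1%:R * x - x by rewrite -natr1; ring.
have -> : a.+2%:R * x = a.+1%:R * x + x by rewrite -[a.+2%:R]natr1; ring.
by rewrite sinB sinD; ring.
Qed.

Lemma sw_half_angle (R : realType) (k n : nat) :
  (k.+1)%:R * (sw n.+1 k)%:R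
  = \sum_(j < k.+1) (1 - (-1) ^+ j) * cot (half_angle R k.+1 j) ^+ 2
      * (1 + 2 * cos (2 * half_angle R k.+1 j)) ^+ n.
Proof.
rewrite sw_smooth_extensions natr_sum mulr_sumr.
under eq_bigr do rewrite smooth_extensions_sine_expansion.
rewrite exchange_big /=; apply: eq_bigr => -[[|j] jk] _ /=.
  by rewrite subrr !mul0r big1 // => a _; rewrite !mul0r.
rewrite -mulr_suml -mulr_sumr; congr (_ * _).
have := @sum_sin_half_angle R k.+1 isT j.+1.
rewrite big_ord_recl mul0r sin0 add0r => ->; last lia.
(* The two parity factors merge: (1 - e)^2 / 2 = 1 - e when e^2 = 1. *)
have : ((-1 : R) ^+ j.+1) ^+ 2 = 1 by rewrite sqrr_sign.
set e := (-1) ^+ _ => e2.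
have -> : (1 - e) * cot (half_angle R k.+1 j.+1)
    * ((1 - e) / 2 * cot (half_angle R k.+1 j.+1))
  = (1 - 2 * e + e ^+ 2) / 2 * cot (half_angle R k.+1 j.+1) ^+ 2 by field.
by rewrite e2; field.
Qed.

Lemma sum_odd_indices (R : realType) (N : nat) (F : nat -> R) :
  \sum_(0 <= j < N) (1 - (-1) ^+ j) * F j
  = 2 * \sum_(0 <= j < N./2) F (2 * j + 1)%N.
Proof.
elim: N => [|N IHN]; first by rewrite !big_geq // mulr0.
rewrite big_nat_recr //= {}IHN uphalf_half -signr_odd.
case: (boolP (odd N)) => oddN; last by rewrite subrr mul0r addr0.
rewrite add1n big_nat_recr //= mulrDr expr1 opprK; congr (_ + _ * F _).
by rewrite -{1}[N]odd_double_half oddN mul2n addnC.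
Qed.

Theorem theorem2p4 (R : realType) (k n : nat) (hk : (1 <= k)%N) (hn : (1 <= n)%N) :
  (sw n k)%:R =
    (k%:R + 1)^-1 *
    \sum_(1 <= j < k.+1)
      (1 + (-1) ^+ (j + 1)) *
      cot (j%:R * pi / (2 * (k%:R + 1))) ^+ 2 *
      (1 + 2 * cos (j%:R * pi / (k%:R + 1))) ^+ (n - 1) :> R
  /\
  (sw n k)%:R =
    2 / (k%:R + 1) *
    \sum_(0 <= j < ((k - 1) %/ 2).+1)
      cot ((2 * j + 1)%:R * pi / (2 * (k%:R + 1))) ^+ 2 *
      (1 + 2 * cos ((2 * j + 1)%:R * pi / (k%:R + 1))) ^+ (n - 1) :> R.
Proof.
case: n hn => // n _; rewrite subSS subn0 natr1.
have N0 : k.+1%:R != 0 :> R by rewrite pnatr_eq0.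
pose F j : R := cot (j%:R * pi / (2 * k.+1%:R)) ^+ 2
                * (1 + 2 * cos (j%:R * pi / k.+1%:R)) ^+ n.
have swE : (sw n.+1 k)%:R
    = k.+1%:R^-1 * \sum_(0 <= j < k.+1) (1 - (-1) ^+ j) * F j :> R.
  apply: (mulfI N0); rewrite mulVKf // sw_half_angle big_mkord.
  apply: eq_bigr => j _; rewrite /F [RHS]mulrA.
  by rewrite mul2_half_angle.
split; rewrite swE.
  congr (_ * _); rewrite big_ltn // subrr mul0r add0r.
  by apply: eq_bigr => j _; rewrite /F mulrA addn1 [(-1) ^+ _.+1]exprS mulN1r.
rewrite sum_odd_indices mulrA [_^-1 * 2]mulrC.
by have -> : k.+1./2 = ((k - 1) %/ 2).+1 by lia.
Qed.
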